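(* Let $(\Omega,d)$ be a Polish metric space and let $\mathcal{P}_1,\mathcal{P}_2\in\mathcal{P}_1(\Omega)$ be two elements of the Wasserstein space of order $1$ of sets of probability measures (that is, $\mathcal{P}_1$ and $\mathcal{P}_2$ are nonempty weakly compact convex sets of Borel probability measures on $\Omega$ satisfying the uniform first-moment tail condition (b) of the context with $p=1$). Then $$\mathcal{W}_1(\mathcal{P}_1,\mathcal{P}_2)=\sup_{\|\varphi\|_{\mathrm{Lip}}\le 1}\left|\mathbb{E}^{\mathcal{P}_1}[\varphi]-\mathbb{E}^{\mathcal{P}_2}[\varphi]\right|,$$ where the supremum is over all functions $\varphi:\Omega\to\mathbb{R}$ that are Lipschitz with respect to $d$ with Lipschitz constant at most $1$.
   Context: $(\Omega,d)$ is a Polish metric space with its Borel $\sigma$-algebra; all probability measures are Borel probability measures on $\Omega$, and $E_\mu[\varphi]$ denotes the integral of $\varphi$ with respect to $\mu$. All sets of probability measures considered are nonempty. For a set $\mathcal{P}$ of probability measures, the sublinear expectation is $\mathbb{E}^{\mathcal{P}}[\varphi]:=\sup_{\mu\in\mathcal{P}}E_\mu[\varphi]$ for real Borel functions $\varphi$. For $p\ge 1$, $W_p(\mu,\nu)=\inf\{E[d(X,Y)^p]^{1/p}:\ \mathrm{law}(X)=\mu,\ \mathrm{law}(Y)=\nu\}$ is the classical Wasserstein distance of order $p$. For sets $\mathcal{P}_1,\mathcal{P}_2$ of probability measures, the generalized Wasserstein distance is $$\mathcal{W}_p(\mathcal{P}_1,\mathcal{P}_2)=\max\Big(\sup_{\mu\in\mathcal{P}_1}\inf_{\nu\in\mathcal{P}_2}W_p(\mu,\nu),\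 \sup_{\nu\in\mathcal{P}_2}\inf_{\mu\in\mathcal{P}_1}W_p(\mu,\nu)\Big).$$ For $p\ge1$, $\mathcal{P}_p(\Omega)$ is the collection of all sets $\mathcal{P}$ of probability measures such that (a) $\mathcal{P}$ is convex and weakly compact (compact for the topology of weak convergence of probability measures); (b) for an arbitrary point $\omega_0\in\Omega$, $\lim_{K\to\infty}\mathbb{E}^{\mathcal{P}}[d(\omega_0,\cdot)^p\mathbf{1}_{\{\omega:\ d(\omega_0,\omega)\ge K\}}]=0$ (this does not depend on the choice of $\omega_0$). *)

(* Defs.v *)
From HB Require Import structures.
From mathcomp Require Import all_boot all_order all_algebra.
From mathcomp Require Import all_classical all_reals all_analysis.
From mathcomp Require Import giry.

Set Implicit Arguments.
Unset Strict Implicit.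
Unset Printing Implicit Defensive.

Import Order.TTheory GRing.Theory Num.Theory.
Import numFieldNormedType.Exports.

Local Open Scope classical_set_scope.
Local Open Scope ring_scope.

HB.mixin Record Topological_isSeparable T & Topological T := {
  separable : exists2 D : set T, countable D & dense D
}.

(* Completeness is that of the metric itself. The library's complete spaces and
   measurable types are pointed, i.e. nonempty; so is any space that carries a
   probability measure. *)
#[short(type="polishMetricType")]
HB.structure Definition PolishMetric (R : numDomainType) :=
  { T of Metric R T & Complete T & Topological_isSeparable T }.

Notation borel T := (g_sigma_algebraType (@open T)).

Section wasserstein_sets.
Context {R : realType} {Omega : polishMetricType R}.

Local Notation prob := (probability (borel Omega) R).

Definition Cb : Type := {f : Omega -> R | continuous f /\ bounded_fun f}.

HB.instance Definition _ := gen_eqMixin Cb.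
HB.instance Definition _ := gen_choiceMixin Cb.

Definition integral_Cb (mu : prob) : {ptws Cb -> R} :=
  fun f => \int[mu]_x sval f x.

(* The topology of weak convergence is the coarsest one for which the integral
   of every bounded continuous function is continuous. *)
Definition weakly_compact (P : set prob) : Prop :=
  compact (P : set (initial_topology integral_Cb)).

(* The library's measures are functions on all subsets, so two measures that
   agree on the Borel sets need not be equal as terms. Hence equalities of
   measures are only required on measurable sets, here and in [coupling_cost]
   (where [≡μ] means precisely that). *)
Definition convex_probabilities (P : set prob) : Prop :=
  forall (mu nu : prob) (t : R), P mu -> P nu -> 0 <= t <= 1 ->
  exists2 lam : prob, P lam & forall A : set (borel Omega), measurable A ->
    (lam A = t%:E * mu A + (1 - t)%:E * nu A)%E.

Definition sublinear_expectation (P : set prob) (phi : Omega -> R) : \bar R :=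
  ereal_sup [set ('E_mu[phi])%E | mu in P].

Definition wasserstein_space (p : R) : set (set prob) :=
  [set P | [/\ P !=set0, convex_probabilities P, weakly_compact P &
    forall w0 : Omega,
      sublinear_expectation P
        (fun w => mdist w0 w `^ p * \1_[set w' | K <= mdist w0 w'] w)
        @[K --> +oo] --> 0%E]].

Definition coupling_cost (p : R) (mu nu : prob) : set (\bar R) :=
  [set c | exists (d : measure_display) (T : measurableType d)
      (Q : probability T R) (X Y : {RV Q >-> borel Omega}),
    [/\ distribution Q X ≡μ mu, distribution Q Y ≡μ nu &
      c = ('E_Q[fun t => (@mdist R Omega (X t) (Y t) `^ p)%R] `^ p^-1)%E]].

Definition wasserstein (p : R) (mu nu : prob) : \bar R :=
  ereal_inf (coupling_cost p mu nu).

Definition generalized_wasserstein (p : R) (P1 P2 : set prob) : \bar R :=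
  maxe
    (ereal_sup [set ereal_inf [set wasserstein p mu nu | nu in P2] | mu in P1])
    (ereal_sup [set ereal_inf [set wasserstein p mu nu | mu in P1] | nu in P2]).

(* The library's [k.-lipschitz f] is restricted to normed modules. *)
Definition lipschitz_le (k : R) : set (Omega -> R) :=
  [set phi | forall x y, `|phi x - phi y| <= k * mdist x y].

End wasserstein_sets.

(* Main.v *)
Require Import Defs.
From mathcomp Require Import all_boot all_order all_algebra.
From mathcomp Require Import all_classical all_reals all_analysis.
From mathcomp Require Import giry measurable_realfun.
From mathcomp Require Import ring lra.

Set Implicit Arguments.
Unset Strict Implicit.
Unset Printing Implicit Defensive.

Import Order.TTheory GRing.Theory Num.Theory.
Import numFieldNormedType.Exports.

Local Open Scope classical_set_scope.
Local Open Scope ring_scope.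

(** Kantorovich duality for sets of measures, by reduction to a finite
transport problem.

Weak duality is one integration: if X and Y have laws mu and nu and phi is
1-Lipschitz, then E_mu[phi] - E_nu[phi] = E[phi(X) - phi(Y)] <= E[d(X, Y)]
([integral_le_wasserstein]); taking the infimum over nu in P2 and the supremum
over mu in P1 bounds the difference of the sublinear expectations by a one-sided
distance ([sublinear_le_directed]).

For the converse, fix mu in P1 and delta > 0.  Since both sides of the claim
are an infimum and a supremum, a measure nu in P2 and a coupling of mu and nu
whose cost exceeds the dual value by a multiple of delta are enough
([exists_close_measure]), and this slack is what makes a finite model
sufficient.

- Discretization ([rounding]).  Let z be a dense sequence.  The distance e_n(x)
  of x to z_0, ..., z_n is continuous and decreases to 0 pointwise, so Dini's
  argument on the weakly compact set P1 `|` P2, with the uniform tail condition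
  in place of boundedness, makes the integral of e_n at most delta for all its
  measures at once.  Sending x to a nearest point among z_0, ..., z_n thus
  turns each measure into a probability vector at a transport cost of at most
  delta.

- Finite minimax duality ([finite_duality]).  For vectors p and q in a convex
  set Q, minimize approximately cost(pi) + lam/2 |s - q|^2 over plans pi with
  row sums p and over q in Q, where s is the vector of column sums of pi.  The
  first-order condition along segments makes phi = lam (s - q) a dual
  potential, and its c-transform a 1-Lipschitz one; hence
  cost(pi) + lam |s - q|^2 is at most the dual value, up to a small error.  A
  large lam makes the repair of the columns of pi ([repair_columns]) nearly
  free.

- Back to Omega.  A 1-Lipschitz function on the points z_i extends to Omega
  ([mcshane_extension]), so the dual value of the finite problem is at most the
  original one plus 2 delta, and a finite plan lifts to a coupling of mu and nu
  that has the prescribed mass on each product of cells ([lift_coupling]). *)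

(** * Finite optimal transport *)

Section finite.
Context {R : realType} (n : nat).
Local Notation I := 'I_n.+1.
Implicit Types (d pi : I -> I -> R) (p q : I -> R).

Definition transport_cost d pi := \sum_i \sum_j pi i j * d i j.
Definition colsum pi (j : I) := \sum_i pi i j.

(** Column sums s are turned into q by keeping the fraction min(s_j, q_j) / s_j
of column j and spreading the freed mass t over the columns in deficit,
independently of its origin.  Only the mass t is moved anew, at a price of at
most M per unit, and t is at most the l^1 distance of s and q. *)
Lemma repair_columns d (M : R) pi q :
  (forall i j, 0 <= d i j <= M) -> (forall i j, 0 <= pi i j) ->
  (forall j, 0 <= q j) -> \sum_j q j = \sum_j colsum pi j ->
  exists pi', [/\ forall i j, 0 <= pi' i j,
    forall i, \sum_j pi' i j = \sum_j pi i j,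
    forall j, colsum pi' j = q j &
    transport_cost d pi' <= transport_cost d pi + M * \sum_j `|colsum pi j - q j|].
Proof.
move=> dM pi0 q0 qs; pose s := colsum pi.
have s0 j : 0 <= s j by exact: sumr_ge0.
pose m j := Num.min (s j) (q j).
pose rho i := \sum_j pi i j * (1 - m j / s j).
pose t := \sum_j (q j - m j).
have m_le_q j : m j <= q j by rewrite /m ge_min lexx orbT.
have m_le_s j : m j <= s j by rewrite /m ge_min lexx.
have m0 j : 0 <= m j by rewrite /m le_min s0 q0.
have piE i j : pi i j = pi i j * (m j / s j) + pi i j * (1 - m j / s j).
  by rewrite -mulrDr addrC subrK mulr1.
have ms1 j : 0 <= m j / s j <= 1.
  rewrite divr_ge0//=; have [->|sj] := eqVneq (s j) 0; first by rewrite invr0 mulr0.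
  by rewrite ler_pdivrMr ?mul1r// lt0r sj s0.
have rho0 i : 0 <= rho i.
  apply: sumr_ge0 => j _; rewrite mulr_ge0// subr_ge0; by case/andP: (ms1 j).
(* With the convention x / 0 = 0, an empty column has m j / s j = 0. *)
have msK j : m j / s j * s j = m j.
  have [sj|sj] := eqVneq (s j) 0; last by rewrite divfK.
  by rewrite sj mulr0; apply/esym/eqP; rewrite eq_le m0 -sj m_le_s.
have t0 : 0 <= t by apply: sumr_ge0 => j _; rewrite subr_ge0.
have rhot : \sum_i rho i = t.
  rewrite /rho exchange_big/=.
  under eq_bigr => j _ do
    rewrite -mulr_suml -/(colsum pi j) -/(s j) mulrBr mulr1 [s j * _]mulrC msK.
  by rewrite /t !sumrB qs.
have tle : t <= \sum_j `|s j - q j|.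
  apply: ler_sum => j _; rewrite /m; case: (leP (s j) (q j)) => h.
    by rewrite distrC ler_norm.
  by rewrite subrr.
have qmt j : t = 0 -> q j - m j = 0.
  move=> /eqP; rewrite psumr_eq0; last by move=> k _; rewrite subr_ge0.
  by move=> /allP/(_ j); rewrite mem_index_enum/= => /(_ isT)/eqP.
have rhot0 i : t = 0 -> rho i = 0.
  rewrite -rhot => /eqP; rewrite psumr_eq0// => /allP/(_ i).
  by rewrite mem_index_enum/= => /(_ isT)/eqP.
have tK a : (t = 0 -> a = 0) -> a / t * t = a.
  by have [t00 ->//|tn0 _] := eqVneq t 0; [rewrite !mul0r | rewrite divfK].
exists (fun i j => pi i j * (m j / s j) + rho i * ((q j - m j) / t)); split.
- move=> i j; rewrite addr_ge0// mulr_ge0//; first by case/andP: (ms1 j).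
  by rewrite divr_ge0// subr_ge0.
- move=> i; rewrite big_split/= -mulr_sumr -mulr_suml -/t.
  rewrite mulrA mulrAC tK; last exact: rhot0.
  by rewrite -big_split/=; apply: eq_bigr => j _; rewrite -piE.
- move=> j; rewrite /colsum big_split/= -!mulr_suml -/(colsum pi j) -/(s j).
  by rewrite rhot mulrC msK mulrC tK ?subrKC//; exact: qmt.
- rewrite /transport_cost.
  apply: (@le_trans _ _ (\sum_i \sum_j (pi i j * d i j + M * (rho i * ((q j - m j) / t))))).
    apply: ler_sum => i _; apply: ler_sum => j _; have /andP[d0 dm] := dM i j.
    rewrite mulrDl lerD//.
      rewrite ler_wpM2r// -[leRHS]mulr1 ler_wpM2l//; by case/andP: (ms1 j).
    by rewrite mulrC ler_wpM2r// mulr_ge0// divr_ge0// subr_ge0.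
  under eq_bigr do rewrite big_split/=; rewrite big_split/= lerD2l.
  under eq_bigr do rewrite -!mulr_sumr -mulr_suml -/t.
  rewrite -mulr_sumr -mulr_suml rhot [t * _]mulrC tK//.
  by rewrite ler_wpM2l//; have /andP[] := dM ord0 ord0; exact: le_trans.
Qed.

Definition sqdist (u v : I -> R) := \sum_j (u j - v j) ^+ 2.

Lemma near_minimizer (T : Type) (S : set T) (F : T -> R) (eta : R) :
  S !=set0 -> (forall z, S z -> 0 <= F z) -> 0 < eta ->
  exists2 z, S z & forall z', S z' -> F z <= F z' + eta.
Proof.
move=> [z0 Sz0] F0 eta0.
have lbF : has_lbound (F @` S) by exists 0 => _ [z Sz <-]; exact: F0.
have infF : has_inf (F @` S) by split=> //; exists (F z0), z0.
have [_ [z Sz <-] zlt] := inf_adherent eta0 infF.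
exists z => // z' Sz'; apply: (le_trans (ltW zlt)); rewrite lerD2r.
by apply: ge_inf => //; exists z'.
Qed.

(** First-order optimality: comparing a near-minimizer of the convex function
cost(pi) + lam/2 |s - q|^2 with the point at parameter th on the segment to a
competitor (pi', q') and dividing by th gives a variational inequality, with an
error of order th when the minimizer is th^2-optimal.  The derivative of the
penalty is the linear form with coefficients lam (s_j - q_j), which will serve
as a dual potential. *)
Lemma penalized_optimality d p (Q : set (I -> R)) (lam delta : R) :
  (forall i j, 0 <= d i j) -> (forall i, 0 <= p i) -> \sum_i p i = 1 ->
  Q !=set0 -> (forall q, Q q -> (forall j, 0 <= q j) /\ \sum_j q j = 1) ->
  (forall q q' t, Q q -> Q q' -> 0 <= t <= 1 ->
     Q (fun j => t * q j + (1 - t) * q' j)) ->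
  0 <= lam -> 0 < delta ->
  exists pi q, [/\ forall i j, 0 <= pi i j, forall i, \sum_j pi i j = p i, Q q &
    forall pi' q', (forall i j, 0 <= pi' i j) ->
      (forall i, \sum_j pi' i j = p i) -> Q q' ->
      transport_cost d pi + lam * sqdist (colsum pi) q <=
      transport_cost d pi' +
        \sum_j lam * (colsum pi j - q j) * (colsum pi' j - q' j) + delta].
Proof.
move=> d0 p0 p1 [q0 Qq0] Qprob Qconv lam0 delta0.
pose S : set ((I -> I -> R) * (I -> R)) := [set z | [/\ forall i j, 0 <= z.1 i j,
  forall i, \sum_j z.1 i j = p i & Q z.2]].
pose F (z : (I -> I -> R) * (I -> R)) :=
  transport_cost d z.1 + lam / 2 * sqdist (colsum z.1) z.2.
(* The error at parameter th is th * B: 1 comes from near-optimality, the rest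
   from the quadratic term, each coordinate of which is at most 2 ^ 2. *)
pose B := 1 + lam / 2 * (4 *+ n.+1).
have B1 : 1 <= B by rewrite /B lerDl mulr_ge0 ?divr_ge0// mulrn_wge0.
pose th := Num.min 1 (delta / B).
have B0 : 0 < B by exact: lt_le_trans B1.
have th0 : 0 < th by rewrite /th lt_min ltr01 divr_gt0.
have th1 : th <= 1 by rewrite /th ge_min lexx.
have thB : th * B <= delta by rewrite -ler_pdivlMr// /th ge_min lexx orbT.
have S0 : S !=set0.
  exists (fun i j => if j == ord0 then p i else 0, q0); split=> //= i.
    by move=> j; case: ifP.
  by rewrite -big_mkcond/= big_pred1_eq.
have F0 z : S z -> 0 <= F z.
  move=> [z1 _ _]; rewrite addr_ge0//.
    by apply: sumr_ge0 => i _; apply: sumr_ge0 => j _; rewrite mulr_ge0.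
  by rewrite mulr_ge0 ?divr_ge0//; apply: sumr_ge0 => j _; rewrite sqr_ge0.
have [[pi q] [/= pi0 pip Qq] zmin] := near_minimizer S0 F0 (exprn_gt0 2 th0).
exists pi, q; split=> // pi' q' pi'0 pi'p Qq'.
have dist1 r u : (forall i j, 0 <= r i j) -> (forall i, \sum_j r i j = p i) ->
    Q u -> forall j, `|colsum r j - u j| <= 1.
  move=> r0 rp Qu j; have [u0 u1] := Qprob _ Qu.
  have uj : u j <= 1 by rewrite -u1 (bigD1 j)//= lerDl sumr_ge0.
  have rj : colsum r j <= 1.
    rewrite -p1; apply: ler_sum => i _.
    by rewrite -rp (bigD1 j)//= lerDl sumr_ge0.
  have rj0 : 0 <= colsum r j by exact: sumr_ge0.
  by have := u0 j; rewrite ler_norml; lra.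
pose zt := ((fun i j => th * pi' i j + (1 - th) * pi i j),
            (fun j => th * q' j + (1 - th) * q j)).
have Szt : S zt.
  split=> /=.
  - by move=> i j; rewrite addr_ge0// mulr_ge0// ?subr_ge0// ltW.
  - by move=> i; rewrite big_split/= -!mulr_sumr pip pi'p; ring.
  - by apply: Qconv => //; rewrite th1 ltW.
have := zmin _ Szt; rewrite /F /zt/=.
set v := fun j => colsum pi j - q j; set v' := fun j => colsum pi' j - q' j.
have -> : transport_cost d (fun i j => th * pi' i j + (1 - th) * pi i j) =
    th * transport_cost d pi' + (1 - th) * transport_cost d pi.
  rewrite /transport_cost !mulr_sumr -big_split/=; apply: eq_bigr => i _.
  by rewrite !mulr_sumr -big_split/=; apply: eq_bigr => j _; ring.
have -> : sqdist (colsum pi) q = \sum_j v j ^+ 2 by [].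
have -> : sqdist (colsum (fun i j => th * pi' i j + (1 - th) * pi i j))
    (fun j => th * q' j + (1 - th) * q j) =
  \sum_j v j ^+ 2 + 2 * th * (\sum_j v j * v' j - \sum_j v j ^+ 2)
  + th ^+ 2 * (\sum_j (v' j - v j) ^+ 2).
  rewrite -sumrB !mulr_sumr -!big_split/=; apply: eq_bigr => j _.
  rewrite /colsum big_split/= -!mulr_sumr -!/(colsum _ _) /v /v'; ring.
have -> : \sum_j lam * v j * v' j = lam * \sum_j v j * v' j.
  by rewrite mulr_sumr; apply: eq_bigr => j _; rewrite mulrA.
have W4 : \sum_j (v' j - v j) ^+ 2 <= 4 *+ n.+1.
  rewrite -[X in _ *+ X]card_ord -sumr_const; apply: ler_sum => j _.
  have := dist1 _ _ pi0 pip Qq j; have := dist1 _ _ pi'0 pi'p Qq' j.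
  rewrite -/(v j) -/(v' j) !ler_norml => h1 h2.
  have : -2 <= v' j - v j <= 2 by lra.
  by nra.
have {W4} := ler_wpM2l (divr_ge0 lam0 (ler0n _ 2)) W4.
set W := \sum_j (v' j - v j) ^+ 2; set V := \sum_j v j ^+ 2.
set V' := \sum_j v j * v' j.
set C := transport_cost d pi; set C' := transport_cost d pi'.
move=> hW hmin; rewrite -(ler_pM2l th0).
have : th * (th * B) <= th * delta by rewrite ler_pM2l.
have : th ^+ 2 * (lam / 2 * W) <= th ^+ 2 * (lam / 2 * (4 *+ n.+1)).
  by rewrite ler_wpM2l// sqr_ge0.
rewrite /B => h1 h2.
apply: le_trans (_ : th * C + th * lam * V + (th * C' + (1 - th) * C +
   lam / 2 * (V + 2 * th * (V' - V) + th ^+ 2 * W) + th ^+ 2) -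
   (C + lam / 2 * V) <= _).
  by lra.
by lra.
Qed.

(** Minimax form of Kantorovich duality on a finite space.  In the inequality of
[penalized_optimality] the best competitor sends the mass of i to a j minimizing
d i j + phi j; this minimum psi i is 1-Lipschitz in i and at most phi i, so that
cost(pi) + lam |s - q|^2 is a lower bound, up to an error, of the dual value of
psi against every q' in Q.  The penalty term then pays for moving the columns
of pi from s to q, because M x <= lam x^2 + M^2 / (4 lam). *)
Lemma finite_duality d p (Q : set (I -> R)) (M c eps : R) :
  (forall i j, 0 <= d i j <= M) -> (forall i, d i i = 0) ->
  (forall i j k, d i k <= d i j + d j k) ->
  (forall i, 0 <= p i) -> \sum_i p i = 1 ->
  Q !=set0 -> (forall q, Q q -> (forall j, 0 <= q j) /\ \sum_j q j = 1) ->
  (forall q q' t, Q q -> Q q' -> 0 <= t <= 1 ->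
     Q (fun j => t * q j + (1 - t) * q' j)) ->
  (forall psi a, (forall i j, psi i - psi j <= d i j) ->
     (forall q, Q q -> a <= \sum_i p i * psi i - \sum_j q j * psi j) -> a <= c) ->
  0 < eps ->
  exists pi, [/\ forall i j, 0 <= pi i j, forall i, \sum_j pi i j = p i,
    Q (colsum pi) & transport_cost d pi <= c + eps].
Proof.
move=> dM dxx dtri p0 p1 Q0 Qprob Qconv dual eps0.
have d0 i j : 0 <= d i j by case/andP: (dM i j).
have M0 : 0 <= M by have /andP[] := dM ord0 ord0; exact: le_trans.
(* The penalty weight is lam + 1, positive even when M = 0; it makes
   n.+1 * M ^+ 2 / (4 * (lam + 1)) at most eps / 4. *)
pose lam := M ^+ 2 *+ n.+1 / eps.
have lam0 : 0 <= lam by rewrite /lam divr_ge0 ?(ltW eps0)// mulrn_wge0// sqr_ge0.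
have [||pi [q [pi0 pip Qq opt]]] := @penalized_optimality d p Q (lam + 1)
  (eps / 2) d0 p0 p1 Q0 Qprob Qconv.
- by rewrite addr_ge0.
- by rewrite divr_gt0.
pose phi j := (lam + 1) * (colsum pi j - q j).
pose best i := [arg min_(j < ord0) (d i j + phi j)]%O.
pose psi i := d i (best i) + phi (best i).
have psi_le i j : psi i <= d i j + phi j.
  by rewrite /psi /best; case: arg_minP => // k _; exact.
pose pi' i j := if j == best i then p i else 0.
have pi'0 i j : 0 <= pi' i j by rewrite /pi'; case: ifP.
have pi'sum i (f : I -> R) : \sum_j pi' i j * f j = p i * f (best i).
  rewrite (bigD1 (best i))//= /pi' eqxx big1 ?addr0// => j /negbTE ->.
  by rewrite mul0r.
have pi'p i : \sum_j pi' i j = p i.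
  by have := pi'sum i (fun=> 1); rewrite mulr1; under eq_bigr do rewrite mulr1.
have : transport_cost d pi + (lam + 1) * sqdist (colsum pi) q - eps / 2 <= c.
  apply: (dual psi).
    move=> i j; rewrite lerBlDr; apply: le_trans (psi_le i (best j)) _.
    by rewrite /psi addrA lerD2r.
  move=> q' Qq'; have [q'0 _] := Qprob _ Qq'.
  rewrite lerBlDr; apply: le_trans (opt _ _ pi'0 pi'p Qq') _.
  rewrite lerD2r -/phi.
  have -> : \sum_j (lam + 1) * (colsum pi j - q j) * (colsum pi' j - q' j) =
      \sum_j colsum pi' j * phi j - \sum_j q' j * phi j.
    by rewrite -sumrB; apply: eq_bigr => j _; rewrite -/(phi j); ring.
  rewrite addrA lerB//; last first.
    apply: ler_sum => j _; rewrite ler_wpM2l//.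
    by rewrite (le_trans (psi_le j j))// dxx add0r.
  rewrite /transport_cost; under eq_bigr do rewrite pi'sum.
  under [X in _ + X]eq_bigr do rewrite /colsum mulr_suml.
  rewrite exchange_big/=; under [X in _ + X]eq_bigr do rewrite pi'sum.
  rewrite -big_split/=; apply: ler_sum => i _.
  by rewrite -mulrDr.
move=> copt.
have [q0 q1] := Qprob _ Qq.
have [|pi2 [pi20 pi2p pi2q cost2]] := repair_columns dM pi0 q0.
  by rewrite q1 /colsum exchange_big/=; under eq_bigr do rewrite pip.
exists pi2; split=> //.
- by move=> i; rewrite pi2p.
- by rewrite (_ : colsum pi2 = q)//; exact/funext.
apply: (le_trans cost2).
have : M * \sum_j `|colsum pi j - q j| <= (lam + 1) * sqdist (colsum pi) q + eps / 4.
  apply: (@le_trans _ _ (\sum_j ((lam + 1) * (colsum pi j - q j) ^+ 2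
      + M ^+ 2 / (4 * (lam + 1))))).
    rewrite mulr_sumr; apply: ler_sum => j _.
    rewrite -[(colsum pi j - q j) ^+ 2]real_normK ?num_real//.
    set x := `|_|; have l1 : 0 < lam + 1 by lra.
    have -> : (lam + 1) * x ^+ 2 + M ^+ 2 / (4 * (lam + 1)) =
       M * x + (2 * (lam + 1) * x - M) ^+ 2 / (4 * (lam + 1)).
      by field; rewrite gt_eqF.
    by rewrite lerDl divr_ge0 ?sqr_ge0// mulr_ge0// ltW.
  rewrite big_split/= -mulr_sumr lerD2l sumr_const card_ord -mulrnAl.
  have l1 : 0 < lam + 1 by lra.
  rewrite ler_pdivrMr ?mulr_gt0//.
  have -> : eps / 4 * (4 * (lam + 1)) = M ^+ 2 *+ n.+1 + eps.
    by rewrite /lam; field; rewrite gt_eqF.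
  by rewrite lerDl ltW.
by lra.
Qed.
End finite.

(** * Measures on the fibers of a finite-valued map *)

Section fibers.
Context d (T : measurableType d) (R : realType) (I : finType) (k : T -> I).
Hypothesis mk : forall i, measurable (k @^-1` [set i]).
Local Open Scope ereal_scope.

Lemma measure_fibers (m : {measure set T -> \bar R}) (B : set T) :
  measurable B -> m B = \sum_i m (B `&` k @^-1` [set i]).
Proof.
move=> mB; rewrite -big_enum/= fsbig_seq ?enum_uniq//.
have -> : [set` enum I] = [set: I].
  by apply/seteqP; split=> // i _; rewrite /= mem_enum.
rewrite -measure_fin_bigcup//=.
- by congr (m _); apply/seteqP; split=> [x Bx|x [i _ []]//]; exists (k x).
- by move=> i j _ _ [x [[_ <-] [_ <-]]].
- by move=> i _; exact: measurableI.
Qed.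

Lemma comp_fibersE (f : I -> R) x :
  (f (k x))%:E = \sum_i (f i)%:E * (\1_(k @^-1` [set i]) x)%:E.
Proof.
rewrite (bigD1 (k x))//= indicE mem_set// mule1 big1 ?adde0// => j /eqP jk.
by rewrite indicE memNset ?mule0//= => /esym.
Qed.

Lemma integrable_fibers (m : {finite_measure set T -> \bar R}) (f : I -> R) :
  m.-integrable setT (fun x => (f (k x))%:E).
Proof.
have intk i : m.-integrable setT (fun x => (\1_(k @^-1` [set i]) x)%:E).
  exact: integrable_indic.
under eq_fun do rewrite comp_fibersE.
apply: integrable_sum => // i _; exact: (integrableZl measurableT (f i) (intk i)).
Qed.

Lemma integral_fibers (m : {finite_measure set T -> \bar R}) (f : I -> R) :
  \int[m]_x (f (k x))%:E = \sum_i (f i)%:E * m (k @^-1` [set i]).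
Proof.
have intk i : m.-integrable setT (fun x => (\1_(k @^-1` [set i]) x)%:E).
  exact: integrable_indic.
under eq_integral do rewrite comp_fibersE.
rewrite integral_sum//=; last by move=> i; exact: integrableZl.
apply: eq_bigr => i _; rewrite integralZl// integral_indic//.
by rewrite setIT.
Qed.

(** The measure with density w \o k, built as a finite sum of restrictions so
that its values need no integral. *)
Lemma reweight_fibers (m : {measure set T -> \bar R}) (w : I -> R) :
  (forall i, (0 <= w i)%R) ->
  exists Q : {measure set T -> \bar R},
  forall B, Q B = \sum_i (w i)%:E * m (B `&` k @^-1` [set i]).
Proof.
move=> w0; pose e t := nth (k point) (enum I) t.
exists (msum (fun t => mscale (NngNum (w0 (e t))) (mrestr m (mk (e t)))) #|I|).
move=> B; pose F i := ((w i)%:E * m (B `&` k @^-1` [set i]))%E.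
transitivity (\sum_(t < #|I|) F (e t)) => //.
by rewrite -(big_mkord xpredT (F \o e)) cardE -(big_nth _ xpredT F) big_enum.
Qed.
End fibers.

Section gluing.
Context d1 d2 (T1 : measurableType d1) (T2 : measurableType d2) (R : realType).
Context (I : finType) (k : T1 -> I) (l : T2 -> I).
Hypothesis mk : forall i, measurable (k @^-1` [set i]).
Hypothesis ml : forall i, measurable (l @^-1` [set i]).
Variables (mu : probability T1 R) (nu : probability T2 R) (pi : I -> I -> R).

(** A plan between the laws of k and l lifts to a coupling of mu and nu: with
p_i and q_j the masses of the cells, mu \x nu reweighted by pi_ij / (p_i q_j) on
the product of cells (i, j).  Inside the cells the two coordinates stay
independent. *)
Lemma lift_coupling :
  (forall i j, 0 <= pi i j) ->
  (forall i, \sum_j pi i j = fine (mu (k @^-1` [set i]))) ->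
  (forall j, \sum_i pi i j = fine (nu (l @^-1` [set j]))) ->
  exists Q : probability (T1 * T2)%type R, [/\
    forall A, measurable A -> Q (A `*` setT) = mu A,
    forall B, measurable B -> Q (setT `*` B) = nu B &
    forall i j, Q ((k @^-1` [set i]) `*` (l @^-1` [set j])) = (pi i j)%:E].
Proof.
move=> pi0 pik pil.
pose p i := fine (mu (k @^-1` [set i])); pose q j := fine (nu (l @^-1` [set j])).
have pE i : mu (k @^-1` [set i]) = (p i)%:E by rewrite fineK// fin_num_measure.
have qE i : nu (l @^-1` [set i]) = (q i)%:E by rewrite fineK// fin_num_measure.
have p0 i : 0 <= p i by exact: fine_ge0.
have q0 i : 0 <= q i by exact: fine_ge0.
pose kl (x : T1 * T2) := (k x.1, l x.2).
have klE ij : kl @^-1` [set ij] = (k @^-1` [set ij.1]) `*` (l @^-1` [set ij.2]).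
  by case: ij => i j; apply/seteqP; split=> -[x y] /=; rewrite /kl/= => -[<- <-].
have mkl ij : measurable (kl @^-1` [set ij]).
  by rewrite klE; exact: measurableX.
pose w (ij : I * I) := pi ij.1 ij.2 / (p ij.1 * q ij.2).
have w0 ij : 0 <= w ij by rewrite divr_ge0// mulr_ge0.
have [Q QE] := reweight_fibers mkl (mu \x nu)%E w0.
have QX A B : measurable A -> measurable B -> Q (A `*` B) =
    (\sum_i \sum_j (w (i, j) * (fine (mu (A `&` k @^-1` [set i])) *
                               fine (nu (B `&` l @^-1` [set j]))))%:E)%E.
  move=> mA mB; rewrite QE pair_bigA/=; apply: eq_bigr => -[i j] _ /=.
  rewrite klE -setXI product_measure1E; try exact: measurableI.
  by rewrite !EFinM !fineK ?fin_num_measure//; exact: measurableI.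
have pi_row i : p i = 0 -> forall j, pi i j = 0.
  move=> pi_0 j; have := pik i; rewrite -/(p i) pi_0 => /eqP.
  by rewrite psumr_eq0// => /allP/(_ j); rewrite mem_index_enum => /(_ isT)/eqP.
have pi_col j : q j = 0 -> forall i, pi i j = 0.
  move=> pi_0 i; have := pil j; rewrite -/(q j) pi_0 => /eqP.
  by rewrite psumr_eq0// => /allP/(_ i); rewrite mem_index_enum => /(_ isT)/eqP.
have QA A : measurable A -> Q (A `*` setT) = mu A.
  move=> mA; rewrite QX// (measure_fibers mk)//; apply: eq_bigr => i _.
  rewrite -[RHS]fineK ?fin_num_measure//; last exact: measurableI.
  rewrite sumEFin; congr EFin.
  under eq_bigr do rewrite setTI -/(q _).
  (* A null cell carries no mass of the plan, so its weight may be anything. *)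
  have [p_0|p_0] := eqVneq (p i) 0.
    have -> : fine (mu (A `&` k @^-1` [set i])) = 0.
      apply/eqP; rewrite eq_le fine_ge0// andbT -p_0 fine_le ?fin_num_measure//.
        exact: measurableI.
      by rewrite le_measure ?inE//; exact: measurableI.
    by rewrite big1// => j _; rewrite mul0r mulr0.
  transitivity (\sum_j pi i j / p i * fine (mu (A `&` k @^-1` [set i]))).
    apply: eq_bigr => j _; rewrite /w/=; have [q_0|q_0] := eqVneq (q j) 0.
      by rewrite pi_col// !mul0r.
    by field; rewrite ?p_0 ?q_0.
  by rewrite -!mulr_suml pik -/(p i) divff// mul1r.
have QB B : measurable B -> Q (setT `*` B) = nu B.
  move=> mB; rewrite QX// exchange_big/= (measure_fibers ml)//; apply: eq_bigr => j _.
  rewrite -[RHS]fineK ?fin_num_measure//; last exact: measurableI.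
  rewrite sumEFin; congr EFin.
  under eq_bigr do rewrite setTI -/(p _).
  have [q_0|q_0] := eqVneq (q j) 0.
    have -> : fine (nu (B `&` l @^-1` [set j])) = 0.
      apply/eqP; rewrite eq_le fine_ge0// andbT -q_0 fine_le ?fin_num_measure//.
        exact: measurableI.
      by rewrite le_measure ?inE//; exact: measurableI.
    by rewrite big1// => i _; rewrite !mulr0.
  transitivity (\sum_i pi i j / q j * fine (nu (B `&` l @^-1` [set j]))).
    apply: eq_bigr => i _; rewrite /w/=; have [p_0|p_0] := eqVneq (p i) 0.
      by rewrite pi_row// !mul0r.
    by field; rewrite ?p_0 ?q_0.
  by rewrite -!mulr_suml pil -/(q j) divff// mul1r.
have Q1 : Q setT = 1%E by rewrite -setXTT QA// probability_setT.
(* Normalizing a measure of mass 1 only changes its type. *)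
have QN B : mnormalize Q \d_point B = Q B.
  by rewrite /mnormalize Q1 onee_eq0/= invr1 mule1.
exists (mnormalize Q \d_point); split=> [A mA|B mB|i j]; apply: (etrans (QN _)).
- exact: QA.
- exact: QB.
rewrite QX//.
rewrite (bigD1 i)//= (bigD1 j)//= !setIid -/(p i) -/(q j) big1 ?adde0; last first.
  move=> j' /eqP j'j; rewrite [X in nu X](_ : _ = set0) ?measure0 ?mulr0//.
  by apply/seteqP; split=> // x [/= -> ] /esym.
rewrite big1 ?adde0; last first.
  move=> i' /eqP i'i; rewrite big1// => j' _.
  rewrite [X in mu X](_ : _ = set0) ?measure0 ?mul0r ?mulr0//.
  by apply/seteqP; split=> // x [/= -> ] /esym.
rewrite /w/=; congr EFin.
have [p_0|p_0] := eqVneq (p i) 0; first by rewrite pi_row// !mul0r.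
have [q_0|q_0] := eqVneq (q j) 0; first by rewrite pi_col// !mul0r.
by field; rewrite ?p_0 ?q_0.
Qed.
End gluing.

(** * Measurability and weak compactness on a Polish metric space *)

Section polish.
Context (R : realType) (Omega : polishMetricType R).
Local Notation prob := (probability (borel Omega) R).
Implicit Types (mu nu : prob) (P : set prob) (phi : Omega -> R).

Lemma measurable_continuous phi :
  continuous phi -> measurable_fun setT (phi : borel Omega -> R).
Proof.
move=> /continuousP cphi; apply: (measurability _ (RGenOpens.measurableE R)).
move=> _ [_ [a [b ->]] <-]; rewrite setTI; apply: sub_sigma_algebra.
exact/cphi/interval_open.
Qed.

Lemma lipschitz_continuous phi : lipschitz_le 1 phi -> continuous phi.
Proof.
move=> phiL x; apply/cvgrPdist_lt => e e0.
have : \forall y \near x, ball x e y by exact: nbhsx_ballx.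
apply: filterS => y; rewrite ballEmdist; apply: le_lt_trans.
by rewrite -[leRHS]mul1r; exact: phiL.
Qed.

Lemma measurable_lipschitz phi :
  lipschitz_le 1 phi -> measurable_fun setT (phi : borel Omega -> R).
Proof. by move=> /lipschitz_continuous/measurable_continuous. Qed.

Lemma lipschitz_mdist (w : Omega) : lipschitz_le 1 (mdist w).
Proof.
move=> x y; rewrite mul1r ler_norml; have := metric_triangle w x y.
by have := metric_triangle w y x; rewrite (metric_sym y x); lra.
Qed.

Lemma dense_sequence :
  exists z : nat -> Omega, forall x e, 0 < e -> exists n, mdist x (z n) < e.
Proof.
have [D cD dD] := @separable R Omega.
have D0 : D !=set0.
  by have [x [_ Dx]] := dD setT (ex_intro _ point I) openT; exists x.
have /pfcard_geP[D00|[z]] := cD.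
  by move: D0; rewrite D00 => -[].
exists z => x e e0.
have [||y [xy Dy]] := dD (interior (ball x e)).
- by exists x; apply: nbhsx_ballx.
- exact: open_interior.
have [n _ zn] := @surj _ _ _ _ z y Dy.
by exists n; rewrite zn; move/interior_subset: xy; rewrite ballEmdist.
Qed.

(** The distance is a function on a product of two Borel spaces, whose sigma
algebra is generated by rectangles and not by open sets, so continuity does not
give measurability.  Separability does: d(x, y) is the countable infimum of
d(z_n, x) + d(z_n, y) over a dense sequence z. *)
Lemma measurable_mdist d (T : measurableType d) (X Y : T -> borel Omega) :
  measurable_fun setT X -> measurable_fun setT Y ->
  measurable_fun setT (fun t => mdist (X t : Omega) (Y t)).
Proof.
move=> mX mY; have [z zD] := dense_sequence.
pose h n t := mdist (z n) (X t) + mdist (z n) (Y t).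
have lb t : lbound (range (h ^~ t)) (mdist (X t : Omega) (Y t)).
  by move=> _ [n _ <-]; rewrite /h (metric_sym (z n) (X t)) metric_triangle.
have -> : (fun t => mdist (X t : Omega) (Y t)) = fun t => infs (h ^~ t) 0%N.
  apply/funext => t; apply/eqP; rewrite eq_le; apply/andP; split.
    apply: lb_le_inf; first by exists (h 0%N t), 0%N.
    by move=> _ [n _ <-]; apply: lb; exists n.
  apply/ler_addgt0Pr => e e0; have [n zn] := zD (X t) _ (divr_gt0 e0 (ltr0n _ 2)).
  apply: le_trans (_ : h n t <= _).
    apply: ge_inf; last by exists n.
    by exists (mdist (X t : Omega) (Y t)) => _ [m _ <-]; apply: lb; exists m.
  have := metric_triangle (z n) (X t) (Y t).
  by move: zn; rewrite (metric_sym _ (z n)) /h; lra.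
apply: measurable_fun_infs => [t _|n].
  by eexists; apply: lb.
have mz := measurable_lipschitz (lipschitz_mdist (z n)).
by apply: measurable_funD;
  [exact: measurableT_comp mz mX|exact: measurableT_comp mz mY].
Qed.

Lemma bounded_integrable mu (phi : Omega -> R) (M : R) : continuous phi ->
  (forall x, 0 <= phi x <= M) -> mu.-integrable setT (EFin \o phi).
Proof.
move=> cphi phiM; apply: measurable_bounded_integrable => //.
- by apply: fin_num_fun_lty; exact: fin_num_measure.
- exact: measurable_continuous.
- exists M; split; first exact: num_real.
  move=> y My x _ /=; have /andP[phi0 phiM'] := phiM x.
  by rewrite ger0_norm// (le_trans phiM')// ltW.
Qed.

Lemma weakly_continuous_integral (phi : Omega -> R) :
  continuous phi -> bounded_fun phi ->
  continuous ((fun mu => (\int[mu]_x phi x)) :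
     initial_topology (@integral_Cb R Omega) -> R).
Proof.
move=> cphi bphi mu.
pose F : Cb := exist _ phi (conj cphi bphi).
exact: (continuous_comp (@initial_continuous _ _ (@integral_Cb R Omega) mu)
  (@proj_continuous (@Cb R Omega) (fun=> R) F _)).
Qed.

(** Dini's theorem on P: the functions mu |-> E_mu[f n] are weakly continuous,
decrease with n and tend to 0 by dominated convergence, hence they do so
uniformly on the weakly compact set P. *)
Lemma weakly_compact_dini P (f : nat -> Omega -> R) (M eps : R) :
  weakly_compact P -> (forall n, continuous (f n)) ->
  (forall n x, 0 <= f n x <= M) ->
  (forall m n x, (m <= n)%N -> f n x <= f m x) ->
  (forall x, f ^~ x @ \oo --> 0) -> 0 < eps ->
  exists n, forall mu, P mu -> (\int[mu]_x (f n x)%:E <= eps%:E)%E.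
Proof.
move=> cP cf fM fdec f0 eps0.
have intf mu n : mu.-integrable setT (EFin \o f n).
  exact: (bounded_integrable mu (cf n) (fM n)).
have fine_int mu n : (\int[mu]_x (f n x)%:E)%E = (\int[mu]_x f n x)%:E.
  by rewrite /Rintegral fineK//; exact: integrable_fin_num (intf mu n).
have /compact_near_coveringP/(_ nat \oo
  (fun n (mu : prob) => \int[mu]_x f n x < eps)) := cP.
case.
  move=> mu _.
  have : (\int[mu]_x (f n x)%:E)%E @[n --> \oo] --> 0%E.
    have [|||||_ _] := @dominated_convergence _ (borel Omega) R mu setT
      measurableT (fun n x => (f n x)%:E) (cst 0%E) (cst M%:E).
    - by move=> n; exact: (measurable_int _ (intf mu n)).
    - exact: measurable_cst.
    - by apply: aeW => x _; apply: cvg_EFin; [exact: nearW|exact: f0].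
    - exact: finite_measure_integrable_cst.
    - apply: aeW => x n _; have /andP[? ?] := fM n x.
      by rewrite gee0_abs lee_fin.
    - by rewrite integral0.
  under eq_fun do rewrite fine_int.
  move=> /fine_cvg/= /cvgrPdist_lt/(_ _ eps0)[N _ /(_ N (leqnn N))].
  rewrite sub0r normrN => muN.
  have muN' : \int[mu]_x f N x < eps by exact: le_lt_trans (ler_norm _) muN.
  have bf : bounded_fun (f N).
    exists M; split; first exact: num_real.
    move=> y My x _ /=; have /andP[f0' fM'] := fM N x.
    by rewrite ger0_norm// (le_trans fM')// ltW.
  have /cvgr_lt/(_ _ muN') near_mu := @weakly_continuous_integral _ (cf N) bf mu.
  exists ([set mu' : prob | \int[mu']_x f N x < eps], [set n | (N <= n)%N]).
    by split => //=; exists N.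
  move=> [mu' n]/= [mu'N Nn]; apply: le_lt_trans mu'N.
  rewrite -lee_fin -!fine_int ge0_le_integral//.
  - by move=> x _; rewrite lee_fin; case/andP: (fM n x).
  - exact: (measurable_int _ (intf mu' n)).
  - exact: (measurable_int _ (intf mu' N)).
  - by move=> x _; rewrite lee_fin; exact: fdec.
move=> N _ /(_ N (leqnn N)) H; exists N => mu Pmu.
by rewrite fine_int lee_fin ltW//; exact: H.
Qed.
End polish.

(** * Discretization *)

Section rounding.
Context (R : realType) (Omega : polishMetricType R).
Local Notation prob := (probability (borel Omega) R).
Implicit Types (mu nu : prob) (P : set prob) (phi : Omega -> R).

Definition tail_mdist (w0 : Omega) (K : R) (w : Omega) : R :=
  mdist w0 w * \1_[set w' | K <= mdist w0 w'] w.

Definition uniform_tail P := forall w0 eps, 0 < eps ->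
  exists2 K, 0 <= K & forall mu, P mu ->
    (\int[mu]_x (tail_mdist w0 K x)%:E <= eps%:E)%E.

Lemma tail_mdist_ge0 w0 K w : 0 <= tail_mdist w0 K w.
Proof. by rewrite mulr_ge0// mdist_ge0. Qed.

Lemma measurable_tail_mdist w0 K :
  measurable_fun setT (tail_mdist w0 K : borel Omega -> R).
Proof.
have md := measurable_lipschitz (@lipschitz_mdist _ _ w0).
apply: measurable_funM => //; apply: measurable_indic.
rewrite -[X in measurable X]setTI.
rewrite (_ : [set w' | _] = mdist w0 @^-1` `[K, +oo[%classic).
  exact: (md measurableT).
by apply/seteqP; split=> x /=; rewrite in_itv/= andbT.
Qed.

Lemma wasserstein_uniform_tail P : wasserstein_space 1 P -> uniform_tail P.
Proof.
move=> [_ _ _ tailP] w0 eps eps0.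
have : nbhs 0%E [set y : \bar R | (y < eps%:E)%E].
  by apply: open_nbhs_nbhs; split; [exact: open_ereal_lt_ereal|rewrite /= lte_fin].
move=> /(tailP w0)/(pinfty_ex_gt0) [K K0 /= HK]; exists K; first exact: ltW.
move=> mu Pmu; apply: le_trans (ltW HK).
apply: ereal_sup_ubound; exists mu => //; rewrite unlock.
by apply: eq_integral => x _; rewrite /tail_mdist powRr1// mdist_ge0.
Qed.

Lemma uniform_tailU P1 P2 :
  uniform_tail P1 -> uniform_tail P2 -> uniform_tail (P1 `|` P2).
Proof.
move=> t1 t2 w0 eps eps0.
have [K1 K10 tK1] := t1 w0 _ eps0; have [K2 K20 tK2] := t2 w0 _ eps0.
exists (Num.max K1 K2) => [|mu Pmu]; first by rewrite le_max K10.
have le K : K <= Num.max K1 K2 ->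
    (\int[mu]_x (tail_mdist w0 (Num.max K1 K2) x)%:E <=
     \int[mu]_x (tail_mdist w0 K x)%:E)%E.
  move=> KM; apply: ge0_le_integral => //.
  - by move=> x _; rewrite lee_fin tail_mdist_ge0.
  - by apply/measurable_EFinP; exact: measurable_tail_mdist.
  - by apply/measurable_EFinP; exact: measurable_tail_mdist.
  - move=> x _; rewrite lee_fin ler_wpM2l ?mdist_ge0// !indicE ler_nat.
    case: (boolP (x \in [set w' | Num.max K1 K2 <= _])) => //.
    by rewrite inE/= => /(le_trans KM) h; rewrite mem_set.
case: Pmu => Pmu.
- by apply: le_trans (tK1 _ Pmu); apply: le; rewrite le_max lexx.
- by apply: le_trans (tK2 _ Pmu); apply: le; rewrite le_max lexx orbT.
Qed.

(** Where phi exceeds K, so does the distance to w0 that dominates it. *)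
Lemma integral_truncation mu w0 (K : R) phi :
  measurable_fun setT (phi : borel Omega -> R) ->
  (forall x, 0 <= phi x <= mdist w0 x) -> 0 <= K ->
  (\int[mu]_x (phi x)%:E <= \int[mu]_x (Num.min K (phi x))%:E
                            + \int[mu]_x (tail_mdist w0 K x)%:E)%E.
Proof.
move=> mphi phid K0.
have mmin : measurable_fun setT (fun x : borel Omega => Num.min K (phi x)).
  by apply: measurable_minr => //; exact: measurable_cst.
have min0 x : 0 <= Num.min K (phi x).
  by rewrite le_min K0; case/andP: (phid x).
rewrite -ge0_integralD//; first last.
- by apply/measurable_EFinP; exact: measurable_tail_mdist.
- by move=> x _; rewrite lee_fin tail_mdist_ge0.
- exact/measurable_EFinP.
- by move=> x _; rewrite lee_fin.
apply: ge0_le_integral => //.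
- by move=> x _; rewrite lee_fin; case/andP: (phid x).
- exact/measurable_EFinP.
- apply/measurable_EFinP/measurable_funD => //; exact: measurable_tail_mdist.
- move=> x _; rewrite lee_fin; case: (leP K (phi x)) => Kphi.
    have /andP[_ phix] := phid x.
    rewrite /tail_mdist indicE mem_set/=; last exact: le_trans phix.
    by rewrite mulr1 (le_trans phix)// lerDr.
  by rewrite lerDl tail_mdist_ge0.
Qed.

Lemma uniform_first_moment P w0 : uniform_tail P ->
  exists C : R, forall mu, P mu -> (\int[mu]_x (mdist w0 x)%:E <= C%:E)%E.
Proof.
move=> /(_ w0 _ ltr01)[K K0 tK]; exists (K + 1) => mu Pmu.
have md := measurable_lipschitz (@lipschitz_mdist _ _ w0).
have dd x : 0 <= mdist w0 x <= mdist w0 x by rewrite mdist_ge0/=.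
apply: le_trans (integral_truncation mu md dd K0) _.
rewrite EFinD leeD ?tK//.
apply: le_trans (_ : \int[mu]_x (cst K%:E x) <= _)%E.
  apply: ge0_le_integral => //.
  - by move=> x _; rewrite lee_fin le_min K0 mdist_ge0.
  - apply/measurable_EFinP/measurable_minr => //; exact: measurable_cst.
  - by move=> x _; rewrite lee_fin ge_min lexx.
by rewrite integral_cst// [X in (_ * X)%E](@probability_setT _ _ _ mu) mule1.
Qed.

(** The recursive choice of a nearest point among z 0, ..., z n makes the
measurability of the rounding map a one-line induction. *)
Fixpoint nearest (z : nat -> Omega) n (x : Omega) : nat :=
  if n is m.+1 then
    if mdist (z m.+1) x < mdist (z (nearest z m x)) x then m.+1 else nearest z m x
  else 0.

Lemma nearest_le z n x : (nearest z n x <= n)%N.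
Proof. by elim: n => //= n IH; case: ifP => // _; exact: leqW. Qed.

Lemma nearest_min z n x i :
  (i <= n)%N -> mdist (z (nearest z n x)) x <= mdist (z i) x.
Proof.
elim: n => [|n IH]/=; first by rewrite leqn0 => /eqP ->.
rewrite leq_eqVlt => /predU1P[->|/IH]; case: ltP => // /ltW.
exact: le_trans.
Qed.

Lemma lipschitz_nearest z n :
  lipschitz_le 1 (fun x => mdist (z (nearest z n x)) x).
Proof.
move=> x y; rewrite mul1r ler_norml.
have := nearest_min z x (nearest_le z n y).
have := nearest_min z y (nearest_le z n x).
have := metric_triangle (z (nearest z n x)) x y.
have := metric_triangle (z (nearest z n y)) y x.
by rewrite (metric_sym y x); lra.
Qed.

Lemma measurable_nearest z n :
  measurable_fun setT (nearest z n : borel Omega -> nat).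
Proof.
elim: n => [|n IH]/=; first exact: measurable_cst.
apply: measurable_fun_ifT => //.
apply: measurable_fun_ltr; apply: measurable_lipschitz.
- exact: lipschitz_mdist.
- exact: lipschitz_nearest.
Qed.

(** One finite set of cells serves all measures of P.  With e_n the distance to
z 0, ..., z n, the truncations min(K, e_n) are bounded, continuous and decrease
to 0, so [weakly_compact_dini] applies to them; what is cut off is controlled by
the tail of the distance to z 0, which dominates e_n. *)
Lemma rounding P (eps : R) : weakly_compact P -> uniform_tail P -> 0 < eps ->
  exists n (z : 'I_n.+1 -> Omega) (k : borel Omega -> 'I_n.+1),
  [/\ forall i, measurable (k @^-1` [set i]),
      measurable_fun setT (fun x : borel Omega => mdist (z (k x)) x) &
      forall mu, P mu -> (\int[mu]_x (mdist (z (k x)) x)%:E <= eps%:E)%E].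
Proof.
move=> cP tP eps0; have [z zD] := dense_sequence Omega.
have eps20 : 0 < eps / 2 by rewrite divr_gt0.
have [K K0 tK] := tP (z 0%N) _ eps20.
pose e n x := mdist (z (nearest z n x)) x.
have e0 n x : 0 <= e n x by exact: mdist_ge0.
have edec m n x : (m <= n)%N -> e n x <= e m x.
  by move=> mn; apply: nearest_min; rewrite (leq_trans (nearest_le _ _ _)).
have [||||n nP] := @weakly_compact_dini _ _ P (fun n x => Num.min K (e n x))
    K (eps / 2) cP _ _ _ _ eps20.
- move=> n; apply: lipschitz_continuous => x y.
  have := lipschitz_nearest z n x y; rewrite -!/(e _ _) !ler_norml !minEle.
  by case: ifP; case: ifP; lra.
- by move=> n x; rewrite le_min K0 e0 ge_min lexx.
- by move=> m n x mn; rewrite le_min !ge_min lexx edec ?orbT.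
- move=> x; apply/cvgrPdist_lt => eta eta0.
  have [N zN] := zD x _ eta0; exists N => // n /= Nn.
  rewrite sub0r normrN ger0_norm; last by rewrite le_min K0 e0.
  rewrite gt_min; apply/orP; right; apply: le_lt_trans zN.
  by rewrite metric_sym; exact: nearest_min.
pose k (x : borel Omega) : 'I_n.+1 := inord (nearest z n x).
have kE x : k x = nearest z n x :> nat by rewrite inordK// ltnS nearest_le.
exists n, (fun i => z i), k.
have me : measurable_fun setT (e n : borel Omega -> R).
  by apply: measurable_lipschitz; exact: lipschitz_nearest.
have keE : (fun x : borel Omega => mdist (z (k x)) x) = e n.
  by apply/funext => x; rewrite kE.
rewrite keE; split=> //.
- move=> i; rewrite (_ : _ @^-1` _ = nearest z n @^-1` [set nat_of_ord i]).
    by rewrite -[X in measurable X]setTI; exact: measurable_nearest.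
  by apply/seteqP; split=> x /=; [move=> <-|rewrite -kE => /ord_inj].
- move=> mu Pmu; under eq_integral do rewrite kE.
  have ed x : 0 <= e n x <= mdist (z 0%N) x by rewrite e0; exact: nearest_min.
  apply: le_trans (integral_truncation mu me ed K0) _.
  by rewrite [in leRHS](splitr eps) EFinD leeD ?nP// tK.
Qed.
End rounding.

(** * Couplings and weak duality *)

Section transport.
Context (R : realType) (Omega : polishMetricType R).
Local Notation prob := (probability (borel Omega) R).
Implicit Types (mu nu : prob) (P : set prob) (phi : Omega -> R).

Lemma lipschitz_integrable P mu phi : uniform_tail P -> P mu ->
  lipschitz_le 1 phi -> mu.-integrable setT (fun x : borel Omega => (phi x)%:E).
Proof.
move=> tP Pmu phiL; have [C PC] := uniform_first_moment (point : Omega) tP.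
have md := measurable_lipschitz (@lipschitz_mdist _ _ (point : Omega)).
have mphi := measurable_lipschitz phiL.
have int_d : mu.-integrable setT (fun x : borel Omega => (mdist (point : Omega) x)%:E).
  apply/integrableP; split; first exact/measurable_EFinP.
  under eq_integral do rewrite gee0_abs ?lee_fin ?mdist_ge0//.
  by apply: le_lt_trans (PC _ Pmu) _; rewrite ltry.
have int_b : mu.-integrable setT
    (fun x : borel Omega =>
       (`|phi point|%:E + (mdist (point : Omega) x)%:E)%E).
  by apply: integrableD => //; exact: finite_measure_integrable_cst.
apply: le_integrable int_b => //; first exact/measurable_EFinP.
move=> x _; rewrite -EFinD !abse_EFin lee_fin [leRHS]ger0_norm ?addr_ge0 ?mdist_ge0//.
have := phiL point x; rewrite mul1r => h.
rewrite -[X in `|X|](subrK (phi point)) [leRHS]addrC (le_trans (ler_normD _ _))//.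
by rewrite lerD2r distrC.
Qed.

Lemma sublinear_expectation_fin P phi : P !=set0 -> uniform_tail P ->
  lipschitz_le 1 phi -> sublinear_expectation P phi \is a fin_num.
Proof.
move=> [mu0 Pmu0] tP phiL; have [C PC] := uniform_first_moment (point : Omega) tP.
have intphi mu Pmu := @lipschitz_integrable P mu phi tP Pmu phiL.
have intd mu Pmu := @lipschitz_integrable P mu _ tP Pmu (lipschitz_mdist point).
have ub mu : P mu -> ('E_mu[phi] <= (`|phi point| + C)%:E)%E.
  move=> Pmu; rewrite unlock.
  apply: le_trans (_ : \int[mu]_x (`|phi point|%:E +
                                   (mdist (point : Omega) x)%:E) <= _)%E.
    apply: le_integral => //; first exact: intphi.
      apply: integrableD => //; first exact: finite_measure_integrable_cst.
      exact: intd.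
    move=> x _; rewrite -EFinD lee_fin; have := phiL point x; rewrite mul1r ler_norml.
    by have := ler_norm (phi point); lra.
  rewrite integralD//; [|exact: finite_measure_integrable_cst|exact: intd].
  rewrite integral_cst// [X in (_ * X)%E](@probability_setT _ _ _ mu) mule1 EFinD.
  by rewrite leeD2l// PC.
have lb : ('E_mu0[phi] <= sublinear_expectation P phi)%E.
  by apply: ereal_sup_ubound; exists mu0.
rewrite fin_numElt; apply/andP; split.
  apply: lt_le_trans lb; rewrite unlock.
  by have := integrable_fin_num measurableT (intphi mu0 Pmu0); rewrite fin_numElt => /andP[].
apply: le_lt_trans (ltry (`|phi point| + C)).
by apply: ge_ereal_sup => _ [mu Pmu <-]; exact: ub.
Qed.

Lemma coupling_cost1P mu nu c : coupling_cost 1 mu nu c <->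
  exists (d : measure_display) (T : measurableType d)
      (Q : probability T R) (X Y : {RV Q >-> borel Omega}),
    [/\ distribution Q X ≡μ mu, distribution Q Y ≡μ nu &
      c = (\int[Q]_t (mdist (X t : Omega) (Y t))%:E)%E].
Proof.
have E d (T : measurableType d) (Q : probability T R) (X Y : {RV Q >-> borel Omega}) :
    ('E_Q[fun t => (@mdist R Omega (X t) (Y t) `^ 1)%R] `^ 1^-1 =
     \int[Q]_t (mdist (X t : Omega) (Y t))%:E)%E.
  rewrite invr1 unlock; under eq_integral do rewrite powRr1 ?mdist_ge0//.
  by rewrite poweRe1// integral_ge0// => t _; rewrite lee_fin mdist_ge0.
by split=> -[d [T [Q [X [Y [hX hY ->]]]]]]; exists d, T, Q, X, Y; split=> //; rewrite E.
Qed.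

Lemma wasserstein_sym mu nu : wasserstein 1 mu nu = wasserstein 1 nu mu.
Proof.
have sub mu' nu' : coupling_cost 1 mu' nu' `<=` coupling_cost 1 nu' mu'.
  move=> c /coupling_cost1P[d [T [Q [X [Y [hX hY ->]]]]]].
  apply/coupling_cost1P; exists d, T, Q, Y, X; split=> //.
  by apply: eq_integral => t _; rewrite metric_sym.
by congr ereal_inf; apply/seteqP; split; exact: sub.
Qed.

(** A measure on the product with given marginals is turned into a pair of
random variables, the form in which couplings enter the Wasserstein distance. *)
Lemma marginal_fst (Q : probability (borel Omega * borel Omega)%type R) mu :
  (forall A, measurable A -> Q (A `*` setT) = mu A) ->
  exists2 X : {RV Q >-> borel Omega},
    X = fst :> (_ -> _) & distribution Q X ≡μ mu.
Proof.
move=> Qmu.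
have fst_mfun : (fst : borel Omega * borel Omega -> borel Omega) \in mfun.
  by rewrite inE; exact: measurable_fst.
exists (mfun_Sub fst_mfun) => // A mA; apply: etrans (Qmu _ mA); congr (Q _).
by apply/seteqP; split=> x //= -[].
Qed.

Lemma marginal_snd (Q : probability (borel Omega * borel Omega)%type R) nu :
  (forall A, measurable A -> Q (setT `*` A) = nu A) ->
  exists2 Y : {RV Q >-> borel Omega},
    Y = snd :> (_ -> _) & distribution Q Y ≡μ nu.
Proof.
move=> Qnu.
have snd_mfun : (snd : borel Omega * borel Omega -> borel Omega) \in mfun.
  by rewrite inE; exact: measurable_snd.
exists (mfun_Sub snd_mfun) => // A mA; apply: etrans (Qnu _ mA); congr (Q _).
by apply/seteqP; split=> x //= -[].
Qed.

Lemma ge0_integral_law d (T : measurableType d) (Q : probability T R)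
    (X : {RV Q >-> borel Omega}) mu (f : borel Omega -> \bar R) :
  distribution Q X ≡μ mu -> measurable_fun setT f -> (forall x, 0 <= f x)%E ->
  (\int[Q]_t f (X t) = \int[mu]_x f x)%E.
Proof.
move=> Xmu mf f0; rewrite -[LHS](ge0_integral_distribution X mf f0).
apply: eq_measure_integral => A mA _; exact: Xmu.
Qed.

(** The law of X agrees with mu on Borel sets only; this is enough, since
integrals see no other sets. *)
Lemma integral_law d (T : measurableType d) (Q : probability T R)
    (X : {RV Q >-> borel Omega}) mu phi : distribution Q X ≡μ mu ->
  mu.-integrable setT (fun x : borel Omega => (phi x)%:E) ->
  Q.-integrable setT (fun t => (phi (X t))%:E) /\
  (\int[Q]_t (phi (X t))%:E = \int[mu]_x (phi x)%:E)%E.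
Proof.
move=> Xmu /integrableP[mphi phioo].
have intX : Q.-integrable setT (fun t => (phi (X t))%:E).
  apply/integrableP; split; first exact: (measurableT_comp mphi).
  rewrite (ge0_integral_law (f := fun x => `|(phi x)%:E|%E) Xmu)//.
  exact: measurableT_comp.
split=> //; rewrite -[LHS](integral_distribution mphi intX).
apply: eq_measure_integral => A mA _; exact: Xmu.
Qed.

Lemma integral_le_wasserstein mu nu phi : lipschitz_le 1 phi ->
  mu.-integrable setT (fun x : borel Omega => (phi x)%:E) ->
  nu.-integrable setT (fun x : borel Omega => (phi x)%:E) ->
  ('E_mu[phi] - 'E_nu[phi] <= wasserstein 1 mu nu)%E.
Proof.
move=> phiL imu inu; apply: le_ereal_inf_tmp => c.
move=> /coupling_cost1P[d [T [Q [X [Y [hX hY ->]]]]]]; rewrite unlock.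
have [iX <-] := integral_law hX imu; have [iY <-] := integral_law hY inu.
rewrite -integralB//.
have mB : measurable_fun setT (fun t => ((phi (X t))%:E - (phi (Y t))%:E)%E).
  exact: measurable_int (integrableB measurableT iX iY).
apply: le_trans (lee_abs _) _; apply: le_trans (le_abse_integral _ _ mB) _ => //.
apply: ge0_le_integral => //.
- exact: measurableT_comp.
- by apply/measurable_EFinP/measurable_mdist.
- move=> t _; rewrite -EFinB abse_EFin lee_fin.
  by rewrite -[leRHS]mul1r; exact: phiL.
Qed.

End transport.

(** * Strong duality *)

Section duality.
Context (R : realType) (Omega : polishMetricType R).
Local Notation prob := (probability (borel Omega) R).
Implicit Types (mu nu : prob) (P : set prob) (phi : Omega -> R).

(** McShane's formula: phi x is the minimum of psi j + d(z_j, x). *)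
Lemma mcshane_extension n (z : 'I_n.+1 -> Omega) (psi : 'I_n.+1 -> R) :
  (forall i j, psi i - psi j <= mdist (z i) (z j)) ->
  exists2 phi, lipschitz_le 1 phi & forall i, phi (z i) = psi i.
Proof.
move=> psiL.
pose best x := [arg min_(j < ord0) (psi j + mdist (z j) x)]%O.
pose phi x := psi (best x) + mdist (z (best x)) x.
have phi_le x j : phi x <= psi j + mdist (z j) x.
  by rewrite /phi /best; case: arg_minP => // k _; exact.
exists phi => [x y|i].
  rewrite mul1r ler_norml.
  have := phi_le x (best y); have := phi_le y (best x).
  have := metric_triangle (z (best x)) x y.
  have := metric_triangle (z (best y)) y x.
  by rewrite (metric_sym y x) -!/(phi _) /phi; lra.
apply/eqP; rewrite eq_le; apply/andP; split.
  by apply: le_trans (phi_le _ i) _; rewrite mdistxx addr0.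
by rewrite /phi metric_sym -lerBlDl.
Qed.

Lemma integral_rounding mu n (z : 'I_n.+1 -> Omega) (k : borel Omega -> 'I_n.+1)
    phi (delta : R) :
  (forall i, measurable (k @^-1` [set i])) ->
  measurable_fun setT (fun x : borel Omega => mdist (z (k x)) x) ->
  (\int[mu]_x (mdist (z (k x)) x)%:E <= delta%:E)%E ->
  lipschitz_le 1 phi -> mu.-integrable setT (fun x : borel Omega => (phi x)%:E) ->
  (`|'E_mu[phi] - (\sum_i fine (mu (k @^-1` [set i])) * phi (z i))%:E|
     <= delta%:E)%E.
Proof.
move=> mk md intd phiL iphi; rewrite unlock.
have sumE : (\int[mu]_x (phi (z (k x)))%:E)%E =
    (\sum_i fine (mu (k @^-1` [set i])) * phi (z i))%:E.
  rewrite (integral_fibers mk mu (phi \o z)) -sumEFin; apply: eq_bigr => i _.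
  by rewrite EFinM fineK ?fin_num_measure// muleC.
have ik : mu.-integrable setT (fun x : borel Omega => (phi (z (k x)))%:E).
  exact: (integrable_fibers mk mu (phi \o z)).
rewrite -sumE -integralB//.
have mB : measurable_fun setT
    (fun x : borel Omega => ((phi x)%:E - (phi (z (k x)))%:E)%E).
  exact: measurable_int (integrableB measurableT iphi ik).
apply: le_trans intd; apply: le_trans (le_abse_integral _ _ mB) _ => //.
apply: ge0_le_integral => //.
- exact: measurableT_comp.
- exact/measurable_EFinP.
- move=> x _; rewrite -EFinB abse_EFin lee_fin distrC.
  by rewrite -[leRHS]mul1r; exact: phiL.
Qed.

(** The error 5 delta consists of 2 delta for comparing the sublinear
expectations of a 1-Lipschitz function with its finite averages, delta from
[finite_duality], and 2 delta for the distances of X and Y to the centers of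
their cells in the lifted coupling. *)
Lemma exists_close_measure (P1 P2 : set prob) mu (c delta : R) :
  wasserstein_space 1 P1 -> wasserstein_space 1 P2 -> P1 mu ->
  (forall phi, lipschitz_le 1 phi ->
    (sublinear_expectation P1 phi - sublinear_expectation P2 phi <= c%:E)%E) ->
  0 < delta ->
  exists2 nu, P2 nu & (wasserstein 1 mu nu <= (c + 5 * delta)%:E)%E.
Proof.
move=> W1 W2 P1mu dual delta0.
have tP1 := wasserstein_uniform_tail W1; have tP2 := wasserstein_uniform_tail W2.
have [P10 _ cP1 _] := W1; have [P20 convP2 cP2 _] := W2.
(* The cells must suit mu and the still unknown nu in P2 alike. *)
have [n [z [k [mk md roundP]]]] :=
  rounding (compactU cP1 cP2 : weakly_compact (P1 `|` P2))
    (uniform_tailU tP1 tP2) delta0.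
pose mass nu i := fine (nu (k @^-1` [set i])).
have mass0 nu i : 0 <= mass nu i by exact: fine_ge0.
have mass1 nu : \sum_i mass nu i = 1.
  apply: EFin_inj; rewrite -sumEFin -(@probability_setT _ _ _ nu).
  rewrite (measure_fibers mk nu measurableT); apply: eq_bigr => i _.
  by rewrite setTI fineK// fin_num_measure.
pose d i j := mdist (z i) (z j).
have dM i j : 0 <= d i j <= \sum_i \sum_j d i j.
  rewrite mdist_ge0/= (bigD1 i)//= (bigD1 j)//= -addrA lerDl.
  by rewrite addr_ge0// ?sumr_ge0// => *; rewrite ?sumr_ge0// => *; exact: mdist_ge0.
have [|||||pi [pi0 pi_row [nu P2nu pi_col] pi_cost]] :=
  @finite_duality R n d (mass mu) [set mass nu | nu in P2] _ (c + 2 * delta)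
    delta dM (fun i => mdistxx (z i))
    (fun i j l => metric_triangle (z i) (z j) (z l)) (mass0 mu) (mass1 mu).
- by have [nu P2nu] := P20; exists (mass nu), nu.
- by move=> _ [nu _ <-].
- move=> _ _ t [nu1 P2nu1 <-] [nu2 P2nu2 <-] t01.
  have [lam P2lam lamE] := convP2 _ _ _ P2nu1 P2nu2 t01.
  exists lam => //; apply/funext => i; rewrite /mass lamE//.
  by rewrite fineD ?fineM// ?fin_numM// fin_num_measure.
- move=> psi a psiL aP2; have [phi phiL phiz] := mcshane_extension psiL.
  have iphi P nu tP Pnu := @lipschitz_integrable _ _ P nu phi tP Pnu phiL.
  have round nu : (P1 `|` P2) nu ->
      nu.-integrable setT (fun x : borel Omega => (phi x)%:E) ->
      `|fine 'E_nu[phi] - \sum_i mass nu i * psi i| <= delta.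
    move=> Pnu inu; rewrite -lee_fin -abse_EFin EFinB fineK.
      have := integral_rounding mk md (roundP _ Pnu) phiL inu.
      by under eq_bigr do rewrite phiz.
    by rewrite unlock; exact: integrable_fin_num.
  have E1 := sublinear_expectation_fin P10 tP1 phiL.
  have E2 := sublinear_expectation_fin P20 tP2 phiL.
  have fin_E P nu : uniform_tail P -> P nu -> 'E_nu[phi]%E \is a fin_num.
    by move=> tP Pnu; rewrite unlock; apply: integrable_fin_num => //; exact: iphi tP Pnu.
  have := dual _ phiL; rewrite -(fineK E1) -(fineK E2) -EFinB lee_fin.
  have mu_le : fine ('E_mu[phi])%E <= fine (sublinear_expectation P1 phi).
    by rewrite fine_le ?(fin_E P1)//; apply: ereal_sup_ubound; exists mu.
  have nu_le : fine (sublinear_expectation P2 phi) <=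
      \sum_i mass mu i * psi i - a + delta.
    rewrite -lee_fin fineK//; apply: ge_ereal_sup => _ [nu P2nu <-].
    rewrite -(fineK (fin_E P2 _ tP2 P2nu)) lee_fin.
    have := round nu (or_intror P2nu) (iphi P2 nu tP2 P2nu).
    by rewrite ler_norml; have := aP2 _ (ex_intro2 _ _ nu P2nu erefl); lra.
  have := round mu (or_introl P1mu) (iphi P1 mu tP1 P1mu).
  by rewrite ler_norml; lra.
- exact: delta0.
have [||Q [Qmu Qnu Qpi]] := @lift_coupling _ _ _ _ R _ k k mk mk mu nu pi pi0.
- exact: pi_row.
- by move=> j; rewrite -/(mass nu j) pi_col.
have [X XE Xmu] := marginal_fst Qmu; have [Y YE Ynu] := marginal_snd Qnu.
exists nu => //; apply: (@le_trans _ _ (\int[Q]_x (mdist (x.1 : Omega) x.2)%:E)%E).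
  apply: ereal_inf_lbound; apply/coupling_cost1P; exists _, _, Q, X, Y.
  by split=> //; rewrite XE YE.
pose e (x : borel Omega) := mdist (z (k x)) x.
pose kk (x : borel Omega * borel Omega) := (k x.1, k x.2).
have kkE ij : kk @^-1` [set ij] = (k @^-1` [set ij.1]) `*` (k @^-1` [set ij.2]).
  by case: ij => i j; apply/seteqP; split=> -[x y] /=; rewrite /kk/= => -[<- <-].
have mkk ij : measurable (kk @^-1` [set ij]) by rewrite kkE; exact: measurableX.
have me : measurable_fun setT (fun x : borel Omega => (e x)%:E).
  exact/measurable_EFinP.
have e_ge0 x : (0 <= (e x)%:E)%E by rewrite lee_fin mdist_ge0.
have e1 : (\int[Q]_x (e x.1)%:E <= delta%:E)%E.
  have := ge0_integral_law Xmu me e_ge0; rewrite XE => ->.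
  by apply: roundP; left.
have e2 : (\int[Q]_x (e x.2)%:E <= delta%:E)%E.
  have := ge0_integral_law Ynu me e_ge0; rewrite YE => ->.
  by apply: roundP; right.
have dE : (\int[Q]_x (d (k x.1) (k x.2))%:E = (transport_cost d pi)%:E)%E.
  rewrite (integral_fibers mkk Q (fun ij => d ij.1 ij.2)) /transport_cost.
  rewrite pair_bigA/= -sumEFin; apply: eq_bigr => -[i j] _.
  by rewrite kkE Qpi/= -EFinM mulrC.
have md2 : measurable_fun setT (fun x : borel Omega * borel Omega => (d (k x.1) (k x.2))%:E).
  exact: measurable_int (integrable_fibers mkk Q (fun ij => d ij.1 ij.2)).
have me1 : measurable_fun setT (fun x : borel Omega * borel Omega => (e x.1)%:E).
  exact: (measurableT_comp me measurable_fst).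
have me2 : measurable_fun setT (fun x : borel Omega * borel Omega => (e x.2)%:E).
  exact: (measurableT_comp me measurable_snd).
apply: le_trans (_ : \int[Q]_x ((d (k x.1) (k x.2))%:E + ((e x.1)%:E + (e x.2)%:E)) <= _)%E.
  apply: ge0_le_integral => //.
  - by move=> x _; rewrite lee_fin mdist_ge0.
  - apply/measurable_EFinP/measurable_mdist; [exact: measurable_fst|exact: measurable_snd].
  - by apply: emeasurable_funD => //; exact: emeasurable_funD.
  - move=> x _; rewrite -!EFinD lee_fin /d /e.
    have := metric_triangle (x.1 : Omega) (z (k x.1)) x.2.
    have := metric_triangle (z (k x.1)) (z (k x.2)) x.2.
    by rewrite (metric_sym (x.1 : Omega) (z _)); lra.
rewrite ge0_integralD//; first last.
- exact: emeasurable_funD.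
- by move=> x _; rewrite adde_ge0.
- by move=> x _; rewrite lee_fin mdist_ge0.
rewrite ge0_integralD// dE.
apply: le_trans (leeD (lexx _) (leeD e1 e2)) _.
by rewrite -!EFinD lee_fin; move: pi_cost; lra.
Qed.

(** The one-sided Hausdorff distance from P1 to P2; the generalized Wasserstein
distance is the larger of its two orientations. *)
Definition directed_wasserstein P1 P2 : \bar R :=
  ereal_sup [set ereal_inf [set wasserstein 1 mu nu | nu in P2] | mu in P1].

Lemma sublinear_le_directed P1 P2 phi :
  wasserstein_space 1 P1 -> wasserstein_space 1 P2 -> lipschitz_le 1 phi ->
  (sublinear_expectation P1 phi - sublinear_expectation P2 phi
     <= directed_wasserstein P1 P2)%E.
Proof.
move=> W1 W2 phiL.
have tP1 := wasserstein_uniform_tail W1; have tP2 := wasserstein_uniform_tail W2.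
have [P10 _ _ _] := W1; have [P20 _ _ _] := W2.
have E2 := sublinear_expectation_fin P20 tP2 phiL.
rewrite leeBlDr//; apply: ge_ereal_sup => _ [mu P1mu <-].
rewrite -leeBlDr//.
apply: le_ereal_sup_tmp; eexists; first by exists mu.
apply: le_ereal_inf_tmp => _ [nu P2nu <-].
have imu := lipschitz_integrable tP1 P1mu phiL.
have inu := lipschitz_integrable tP2 P2nu phiL.
apply: le_trans (integral_le_wasserstein phiL imu inu).
by apply: leeB => //; apply: ereal_sup_ubound; exists nu.
Qed.

Lemma directed_le_dual P1 P2 (S : \bar R) :
  wasserstein_space 1 P1 -> wasserstein_space 1 P2 ->
  (forall phi, lipschitz_le 1 phi ->
    (sublinear_expectation P1 phi - sublinear_expectation P2 phi <= S)%E) ->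
  (directed_wasserstein P1 P2 <= S)%E.
Proof.
move=> W1 W2 SP.
have tP1 := wasserstein_uniform_tail W1; have tP2 := wasserstein_uniform_tail W2.
have [P10 _ _ _] := W1; have [P20 _ _ _] := W2.
apply: ge_ereal_sup => _ [mu P1mu <-].
case: S SP => [c SP||].
- apply/lee_addgt0Pr => eps eps0.
  have [nu P2nu nuW] := exists_close_measure W1 W2 P1mu SP (divr_gt0 eps0 (ltr0n _ 5)).
  apply: ge_ereal_inf; exists (wasserstein 1 mu nu); first by exists nu.
  by move: nuW; rewrite EFinD mulrCA divff// mulr1.
- by rewrite leey.
(* The zero function excludes S = -oo. *)
- have L0 : lipschitz_le 1 (fun _ : Omega => 0 : R).
    by move=> x y; rewrite subrr normr0 mul1r mdist_ge0.
  move=> /(_ _ L0); rewrite leeNy_eq => /eqP.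
  have := sublinear_expectation_fin P10 tP1 L0.
  have := sublinear_expectation_fin P20 tP2 L0.
  by case: sublinear_expectation => // r _; case: sublinear_expectation.
Qed.

End duality.

Theorem theorem3p1 (R : realType) (Omega : polishMetricType R)
    (P1 P2 : set (probability (borel Omega) R)) :
  wasserstein_space 1 P1 -> wasserstein_space 1 P2 ->
  generalized_wasserstein 1 P1 P2 =
  ereal_sup [set `| sublinear_expectation P1 phi
                    - sublinear_expectation P2 phi |%E
            | phi in lipschitz_le 1].
Proof.
move=> W1 W2.
have gE : generalized_wasserstein 1 P1 P2 =
    maxe (directed_wasserstein P1 P2) (directed_wasserstein P2 P1).
  rewrite /generalized_wasserstein /directed_wasserstein; congr (maxe _ (ereal_sup _)).
  apply: eq_imagel => nu _; congr ereal_inf.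
  by apply: eq_imagel => mu _; exact: wasserstein_sym.
have [P10 _ _ _] := W1; have [P20 _ _ _] := W2.
have E1 phi := @sublinear_expectation_fin _ _ _ phi P10 (wasserstein_uniform_tail W1).
have E2 phi := @sublinear_expectation_fin _ _ _ phi P20 (wasserstein_uniform_tail W2).
rewrite gE; apply/eqP; rewrite eq_le; apply/andP; split.
- rewrite ge_max; apply/andP; split; apply: directed_le_dual => // phi phiL.
  + by apply: le_trans (lee_abs _) _; apply: ereal_sup_ubound; exists phi.
  + apply: le_trans (lee_abs _) _; apply: ereal_sup_ubound; exists phi => //.
    by rewrite -abseN fin_num_oppeB ?E2// addeC.
- apply: ge_ereal_sup => _ [phi phiL <-]; rewrite le_max.
  have := sublinear_le_directed W1 W2 phiL; have := sublinear_le_directed W2 W1 phiL.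
  rewrite -(fineK (E1 _ phiL)) -(fineK (E2 _ phiL)) -!EFinB abse_EFin => h21 h12.
  by case: ger0P => _; rewrite ?opprB ?h12// h21 orbT.
Qed.
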